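(* Let $(X,\mathcal{E})$ be a coarse space. Assume that $A$ and $B$ are two asymptotically disjoint subsets of the asymptotic resemblance space $(X,\lambda_{\mathcal{E}})$. Then each large scale separator between $A$ and $B$ in $(X,\lambda_{\mathcal{E}})$ is an asymptotic cut between $A$ and $B$ in $(X,\mathcal{E})$.
   Context: A coarse structure $\mathcal{E}$ on a nonempty set $X$ is a family of subsets of $X\times X$, closed under taking subsets, such that for all $E,F\in\mathcal{E}$ the sets $E\cup F$, $E^{-1}=\{(y,x)\mid (x,y)\in E\}$ and $E\circ F=\{(x,y)\mid \exists z\in X:\ (x,z)\in F,\ (z,y)\in E\}$ belong to $\mathcal{E}$. Standing assumption: every coarse structure contains the diagonal $\{(x,x)\mid x\in X\}$ and contains $\{(x,y)\}$ for all $x,y\in X$. For $E\in\mathcal{E}$, $x\in X$ and $A\subseteq X$, $E(x)=\{y\in X\mid (y,x)\in E\}$ and $E(A)=\bigcup_{x\in A}E(x)$. For $A,B\subseteq X$, $A\lambda_{\mathcal{E}}B$ means that $A\subseteq E(B)$ and $B\subseteq E(A)$ for some $E\in\mathcal{E}$. A subset $B\subseteq X$ is bounded if $B\times B\in\mathcal{E}$ (equivalently, $B=\emptyset$ or $B\lambda_{\mathcal{E}}\{x\}$ for some $x\in X$). Two subsets $A,B$ of $X$ are asymptotically disjoint if whenever $L_1\subseteq A$, $L_2\subseteq B$ and $L_1\lambda_{\mathcal{E}}L_2$, then $L_1$ and $L_2$ are bounded. Let $A,B$ be asymptotically disjoint subsets of $X$. A subset $C\subseteq X$ is a large scale separator between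 $A$ and $B$ if $C$ is asymptotically disjoint from both $A$ and $B$ and $X=X_1\cup X_2$ such that $X_1$ and $X_2$ are asymptotically disjoint from $A$ and $B$ respectively, and whenever $L_1\lambda_{\mathcal{E}}L_2$ with $L_1\subseteq X_1$ and $L_2\subseteq X_2$, there is a subset $L$ of $C$ with $L_1\lambda_{\mathcal{E}}L$. For $E\in\mathcal{E}$, an $E$-chain from $a\in X$ to $b\in X$ is a finite sequence $a=x_0,\dots,x_n=b$ with $(x_i,x_{i+1})\in E$ for all $i\in\{0,\dots,n-1\}$. A subset $C\subseteq X$ is an asymptotic cut between $A$ and $B$ if $C$ is asymptotically disjoint from both $A$ and $B$ and for each $E\in\mathcal{E}$ there exists $F\in\mathcal{E}$ such that each $E$-chain from an element of $A$ to an element of $B$ meets $F(C)$.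
   Formalization: The separator C is additionally assumed nonempty whenever A and B are both nonempty; otherwise the claim fails, e.g. for X a single point, A = B = X and C empty. *)

(* Defs.v *)
From mathcomp Require Import all_boot.
From mathcomp Require Import boolp classical_sets.

Set Implicit Arguments.
Unset Strict Implicit.
Unset Printing Implicit Defensive.

Local Open Scope classical_set_scope.
Local Open Scope relation_scope.

(* In MathComp-Analysis [E \; F] applies F first:
   it contains (x, y) when (x, z) is in F and (z, y) is in E for some z. *)
Record coarse_structure (X : Type) (EE : set (set (X * X))) : Prop := {
  coarse_nonempty : [set: X] !=set0 ;
  coarse_sub : forall E F, EE F -> E `<=` F -> EE E ;
  coarse_setU : forall E F, EE E -> EE F -> EE (E `|` F) ;
  coarse_inv : forall E, EE E -> EE E^-1 ;
  coarse_comp : forall E F, EE E -> EE F -> EE (E \; F) ;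
  coarse_diag : EE [set xy | xy.1 = xy.2] ;
  coarse_pair : forall x y, EE [set (x, y)]
}.

Section CoarseDefs.
Variable X : Type.

(* E(A); for a singleton, E(x) consists of the y with (y, x), not (x, y),
   in E. *)
Definition thickening (E : set (X * X)) (A : set X) : set X :=
  \bigcup_(x in A) [set y | E (y, x)].

Variable EE : set (set (X * X)).

Definition resemblance (A B : set X) : Prop :=
  exists2 E, EE E & A `<=` thickening E B /\ B `<=` thickening E A.

Definition coarse_bounded (B : set X) : Prop := EE (B `*` B).

Definition asymptotically_disjoint (A B : set X) : Prop :=
  forall L1 L2, L1 `<=` A -> L2 `<=` B -> resemblance L1 L2 ->
    coarse_bounded L1 /\ coarse_bounded L2.

Definition large_scale_separator (A B C : set X) : Prop :=
  [/\ asymptotically_disjoint C A,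
      asymptotically_disjoint C B &
      exists X1 X2 : set X,
        [/\ [set: X] = X1 `|` X2,
            asymptotically_disjoint X1 A,
            asymptotically_disjoint X2 B &
            forall L1 L2, L1 `<=` X1 -> L2 `<=` X2 -> resemblance L1 L2 ->
              exists2 L, L `<=` C & resemblance L1 L]].

(* The chain is x 0, ..., x n; the values of x beyond n are irrelevant. *)
Definition is_chain (E : set (X * X)) (a b : X) (n : nat) (x : nat -> X) :
    Prop :=
  [/\ x 0%N = a, x n = b & forall i, (i < n)%N -> E (x i, x i.+1)].

(* Since F(C) is empty when C is, the empty set is an asymptotic cut between
   A and B only if A or B is empty. *)
Definition asymptotic_cut (A B C : set X) : Prop :=
  [/\ asymptotically_disjoint C A,
      asymptotically_disjoint C B &
      forall E, EE E -> exists2 F, EE F &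
        forall a b n x, A a -> B b -> is_chain E a b n x ->
          exists2 i, (i <= n)%N & thickening F C (x i)].

End CoarseDefs.

(* Main.v *)
(* A chain from A to B starts in X2 unless its start lies in the bounded set
   A `&` X1, and ends outside X2 unless its end lies in the bounded set
   B `&` X2.  Bounded sets lie in a thickening of the nonempty set C; otherwise
   the chain steps from X2 into X1.  The endpoints of all such E-steps form two
   resembling sets L1 in X1 and L2 in X2, so L1 lies in a thickening of C. *)

Require Import Defs.
From mathcomp Require Import all_boot.
From mathcomp Require Import boolp classical_sets.

Local Open Scope classical_set_scope.

Lemma thickeningS {X : Type} {E F : set (X * X)} {A B : set X} :
  E `<=` F -> A `<=` B -> thickening E A `<=` thickening F B.
Proof. by move=> EF AB y [x Ax Eyx]; exists x; [exact: AB|exact: EF]. Qed.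

Lemma bounded_sub_thickening {X : Type} {EE : set (set (X * X))}
    {D C : set X} :
  coarse_structure EE -> coarse_bounded EE D -> C !=set0 ->
  exists2 F, EE F & D `<=` thickening F C.
Proof.
move=> hEE bD [c Cc]; have [[d Dd]|D0] := pselect (D !=set0); last first.
  exists (D `*` D) => // x Dx.
  by case: D0; exists x.
(* This composite is [D]*[[set c]]: go from any point of [D] to [d], then to [c]. *)
exists ([set (d, c)] \; (D `*` D))%relation.
  by apply: (coarse_comp hEE) => //; exact: coarse_pair.
by move=> x Dx; exists c => //=; exists d.
Qed.

(** The intersection lies in both sets and resembles itself through the diagonal. *)
Lemma asymptotically_disjoint_setI {X : Type} {EE : set (set (X * X))}
    {A B : set X} :
  coarse_structure EE -> asymptotically_disjoint EE A B ->
  coarse_bounded EE (A `&` B).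
Proof.
move=> hEE /(_ (A `&` B) (A `&` B)) [||//|//].
- exact: subIsetl.
- exact: subIsetr.
- exists [set xy | xy.1 = xy.2]; first exact: coarse_diag hEE.
  by split=> x ABx; exists x.
Qed.

(** Scanning down from [n], the first index satisfying [P] is an exit. *)
Lemma exists_exit (P : nat -> Prop) (n : nat) :
  P 0 -> ~ P n -> exists2 i, i < n & P i /\ ~ P i.+1.
Proof.
move=> P0; elim: n => [//|n IHn] nPn1.
have [Pn|/IHn[i lt_in Pi]] := pselect (P n); first by exists n.
by exists i => //; exact: ltnW.
Qed.

Lemma resemblance_steps {X : Type} {EE : set (set (X * X))}
    {E : set (X * X)} (X1 X2 : set X) :
  coarse_structure EE -> EE E ->
  resemblance EE [set y | X1 y /\ exists2 x, X2 x & E (x, y)]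
                 [set x | X2 x /\ exists2 y, X1 y & E (x, y)].
Proof.
(* [E] takes sources to targets; [E^-1] covers the other direction. *)
move=> hEE EEE; exists (E `|` E^-1%relation).
  exact: (coarse_setU hEE EEE (coarse_inv hEE EEE)).
split=> [y [X1y [x X2x Exy]]|x [X2x [y X1y Exy]]].
- by exists x; [split=> //; exists y|right].
- by exists y; [split=> //; exists x|left].
Qed.

Theorem proposition4p10 (X : Type) (EE : set (set (X * X)))
    (hEE : coarse_structure EE) (A B : set X)
    (hAB : asymptotically_disjoint EE A B) (C : set X)
    (hC : A !=set0 -> B !=set0 -> C !=set0) :
  large_scale_separator EE A B C -> asymptotic_cut EE A B C.
Proof.
move=> [CA CB [X1 [X2 [X12 X1A X2B sep]]]]; split=> // E EEE.
have [[A0 B0]|AB0] := pselect (A !=set0 /\ B !=set0); last first.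
  by exists E => // a b n x Aa Bb; case: AB0; split; [exists a|exists b].
have C0 := hC A0 B0.
have [F1 EF1 sF1] := bounded_sub_thickening hEE
  (asymptotically_disjoint_setI hEE X1A) C0.
have [F2 EF2 sF2] := bounded_sub_thickening hEE
  (asymptotically_disjoint_setI hEE X2B) C0.
(* Treating all [E]-steps at once makes [F3] independent of the chain. *)
have [||L LC [F3 EF3 [sF3 _]]] := sep _ _ _ _ (resemblance_steps X1 X2 hEE EEE).
- by move=> y [].
- by move=> x [].
have sub1 : F1 `<=` F1 `|` F2 `|` F3 by move=> p; left; left.
have sub2 : F2 `<=` F1 `|` F2 `|` F3 by move=> p; left; right.
have sub3 : F3 `<=` F1 `|` F2 `|` F3 by move=> p; right.
exists (F1 `|` F2 `|` F3).
  exact: (coarse_setU hEE (coarse_setU hEE EF1 EF2) EF3).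
move=> a b n x Aa Bb [x0 xn xE].
(* [X1] and [X2] may overlap, so the case split is on membership in [X2] alone. *)
have X1N y : ~ X2 y -> X1 y by have : [set: X] y by []; rewrite X12 => -[].
have [X2a|/X1N X1a] := pselect (X2 a); last first.
  exists 0 => //; rewrite x0.
  apply: (thickeningS sub1 (@subset_refl _ C)); exact: sF1.
have [X2b|nX2b] := pselect (X2 b).
  exists n => //; rewrite xn.
  apply: (thickeningS sub2 (@subset_refl _ C)); exact: sF2.
have [||i lt_in [X2i /X1N X1i]] := exists_exit (fun i => X2 (x i)) n.
- by rewrite x0.
- by rewrite xn.
(* [F3] controls the targets of steps, hence the index [i.+1]. *)
exists i.+1 => //; apply: (thickeningS sub3 LC); apply: sF3.
by split=> //; exists (x i) => //; exact: xE.
Qed.
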